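(* Let $\mathcal C\subseteq\mathbb{F}_q^n$ be a nonempty $q$-ary code of length $n$ with $M=|\mathcal C|$ and distance distribution $\{B_i\}_{i=0}^n$, and let $r$ be the remainder of $M$ upon division by $q$. Then for each $k=1,2,\dots,n$, $$\sum_{i=0}^n P_k(n;i)B_i\ \ge\ \frac{1}{M}\,r(q-r)(q-1)^{k-1}\binom{n}{k}.$$
   Context: $\mathbb{F}_q$ is a finite field with $q$ elements. The Hamming distance $d(u,v)$ of $u,v\in\mathbb{F}_q^n$ is the number of coordinates where they differ. The distance distribution of $\mathcal C$ is $B_i=\frac{1}{|\mathcal C|}|\{(u,v): u,v\in\mathcal C,\ d(u,v)=i\}|$. The Krawtchouk polynomial is $P_k(n;x)=\sum_{j=0}^k(-1)^j(q-1)^{k-j}\binom{x}{j}\binom{n-x}{k-j}$. *)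

(* Defs.v *)
From HB Require Import structures.
From mathcomp Require Import all_boot all_order all_algebra.

Set Implicit Arguments.
Unset Strict Implicit.
Unset Printing Implicit Defensive.

Import GRing.Theory Num.Theory.

Local Open Scope ring_scope.

Definition hamming_dist (F : finFieldType) (n : nat) (u v : 'rV[F]_n) : nat :=
  #|[set i : 'I_n | u 0 i != v 0 i]|.

(* The pairs (u, v) are ordered, and u = v is allowed. *)
Definition dist_distr (R : realFieldType) (F : finFieldType) (n : nat)
    (C : {set 'rV[F]_n}) (i : nat) : R :=
  #|[set uv in setX C C | hamming_dist uv.1 uv.2 == i]|%:R / #|C|%:R.

(* The value P_k(n; x) at an integer point 0 <= x <= n, so that the
   subtraction n - x is not truncated. *)
Definition krawtchouk (R : realFieldType) (q n k x : nat) : R :=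
  \sum_(0 <= j < k.+1)
    (-1) ^+ j * (q%:R - 1) ^+ (k - j) * 'C(x, j)%:R * 'C(n - x, k - j)%:R.

(* Main.v *)
(** The idea is to replace characters by counting. For [w] in [F^n] let
    [g_w(t) = sum_a (q [a.w = t] - 1) z^(wt a)], the sum being over all [a] in [F^n].
    Adding a coordinate multiplies [g_w] by [1 + (q-1)z] or by [1 - z], according to
    whether that coordinate of [w] is zero, so [g_w(0)] is [q - 1] times the generating
    function of the Krawtchouk values at [wt w]. Hence [q - 1] times the sum of
    [P_k(n; d(u,v))] over pairs in [C] is the sum, over the [binom(n,k) (q-1)^k]
    vectors [a] of weight [k], of [q sum_t N_t^2 - M^2] where [N_t] counts the codewords
    with [a.u = t]. As the [q] integers [N_t] add up to [M], each such term is at least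
    [r (q - r)]. *)
Require Import Defs.
From HB Require Import structures.
From mathcomp Require Import all_boot all_order all_algebra.
From mathcomp Require Import ring lra.

Set Implicit Arguments.
Unset Strict Implicit.
Unset Printing Implicit Defensive.

Import GRing.Theory Num.Theory.

Local Open Scope ring_scope.

Lemma coef_1DZX_exp (R : comNzRingType) (c : R) (m k : nat) :
  ((1 + c *: 'X) ^+ m)`_k = c ^+ k * 'C(m, k)%:R.
Proof.
have -> : (1 + c *: 'X) ^+ m = \poly_(i < m.+1) (c ^+ i * 'C(m, i)%:R).
  rewrite exprDn poly_def; apply: eq_bigr => i _.
  by rewrite expr1n mul1r exprZn -scaler_nat scalerA mulrC.
by rewrite coef_poly ltnS; case: leqP => // /bin_small ->; rewrite mulr0.
Qed.

(** The defining sum is the Cauchy product of the two binomial expansions. *)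
Lemma krawtchoukE (R : realFieldType) (q n k x : nat) :
  krawtchouk R q n k x =
    ((1 + (-1) *: 'X) ^+ x * (1 + (q%:R - 1) *: 'X) ^+ (n - x))`_k.
Proof.
rewrite coefM /krawtchouk big_mkord; apply: eq_bigr => j _.
by rewrite !coef_1DZX_exp; ring.
Qed.

Definition dot (F : finFieldType) (n : nat) (a w : 'rV[F]_n) : F :=
  \sum_i a 0 i * w 0 i.

(** A sum rather than a cardinality, so that the first coordinate splits off as it does in [dot]. *)
Definition wt (F : finFieldType) (n : nat) (a : 'rV[F]_n) : nat :=
  \sum_i (a 0%R i != 0%R).

Lemma wt_sub (F : finFieldType) (n : nat) (u v : 'rV[F]_n) :
  wt (u - v) = hamming_dist u v.
Proof.
rewrite /hamming_dist -sum1dep_card big_mkcond /wt; apply: eq_bigr => i _.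
by rewrite !mxE subr_eq0; case: eqP.
Qed.

Lemma wt_le (F : finFieldType) (n : nat) (u : 'rV[F]_n) : (wt u <= n)%N.
Proof.
rewrite -[X in (_ <= X)%N]card_ord -sum1_card.
by apply: leq_sum => i _; case: eqP.
Qed.

Lemma dotBr (F : finFieldType) (n : nat) (a u v : 'rV[F]_n) :
  dot a (u - v) = dot a u - dot a v.
Proof.
by rewrite /dot -sumrB; apply: eq_bigr => i _; rewrite !mxE mulrBr.
Qed.

Lemma sum_rV_recl (V : nmodType) (F : finFieldType) (n : nat)
    (f : 'rV[F]_(1 + n) -> V) :
  \sum_a f a = \sum_b \sum_(a : 'rV[F]_n) f (row_mx b%:M a).
Proof.
rewrite pair_big /=.
rewrite (reindex (fun p : F * 'rV[F]_n => row_mx p.1%:M p.2 : 'rV[F]_(1 + n))) //.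
exists (fun a : 'rV[F]_(1 + n) => (lsubmx a 0 0, rsubmx a)) => [[b a] _ | a _] /=.
  by rewrite row_mxKl row_mxKr mxE eqxx.
by rewrite -mx11_scalar hsubmxK.
Qed.

Lemma row_mx0l (F : finFieldType) (n : nat) (b : F) (a : 'rV[F]_n) :
  (row_mx b%:M a : 'rV_(1 + n)) 0 ord0 = b.
Proof.
have -> : ord0 = lshift n (0 : 'I_1) by apply: val_inj.
by rewrite row_mxEl mxE eqxx.
Qed.

Lemma row_mx0r (F : finFieldType) (n : nat) (b : F) (a : 'rV[F]_n) (i : 'I_n) :
  (row_mx b%:M a : 'rV_(1 + n)) 0 (lift ord0 i) = a 0 i.
Proof.
have -> : lift ord0 i = rshift 1 i by apply: val_inj.
by rewrite row_mxEr.
Qed.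

Lemma dot_recl (F : finFieldType) (n : nat) (b c : F) (a w : 'rV[F]_n) :
  dot (row_mx b%:M a : 'rV_(1 + n)) (row_mx c%:M w) = b * c + dot a w.
Proof.
rewrite /dot big_ord_recl !row_mx0l; congr (_ + _).
by apply: eq_bigr => i _; rewrite !row_mx0r.
Qed.

Lemma wt_recl (F : finFieldType) (n : nat) (b : F) (a : 'rV[F]_n) :
  wt (row_mx b%:M a : 'rV_(1 + n)) = ((b != 0%R) + wt a)%N.
Proof.
rewrite /wt big_ord_recl !row_mx0l; congr (_ + _)%N.
by apply: eq_bigr => i _; rewrite !row_mx0r.
Qed.

(* [ctr t] is the sum of all nontrivial additive characters of [F] at [t]. *)
Definition ctr (R : comNzRingType) (F : finFieldType) (t : F) : R :=
  #|F|%:R * (t == 0)%:R - 1.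

Lemma sum_ctr (R : comNzRingType) (F : finFieldType) :
  \sum_(t : F) ctr R t = 0.
Proof.
rewrite sumrB -mulr_sumr sumr_const (bigD1 (0 : F)) //= eqxx big1 => [|t /negbTE ->//].
by rewrite addr0 mulr1 subrr.
Qed.

(** For [c != 0], [t - b * c] runs over all of [F] as [b] does; the full sum vanishes, so omitting
    [b = 0] leaves [- ctr R t]. *)
Lemma sum_ctr_neq0 (R : comNzRingType) (F : finFieldType) (c t : F) :
  \sum_(b | b != 0) ctr R (t - b * c) =
    ctr R t * (if c == 0 then #|F|%:R - 1 else -1).
Proof.
case: eqVneq => [-> | c0].
  under eq_bigr do rewrite mulr0 subr0.
  rewrite sumr_const -[LHS]mulr_natr; congr (_ * _).
  by rewrite cardC1 -subn1 natrB // (cardD1 (0 : F)).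
have /esym := sum_ctr R F; rewrite (reindex (fun b => t - b * c)) /=; last first.
  exists (fun s => (t - s) / c) => b _; last by rewrite divfK // subKr.
  by rewrite subKr mulfK.
rewrite (bigD1 0) //= mul0r subr0 => /eqP.
by rewrite eq_sym addrC addr_eq0 mulrN1 => /eqP.
Qed.

(** Induction on [n]. The shift [t] has to be arbitrary, since a first coordinate [b] of [a] against
    [c] of [w] turns [t] into [t - b * c]. *)
Lemma gen_ctr_dot (R : comNzRingType) (F : finFieldType) (n : nat)
    (w : 'rV[F]_n) (t : F) :
  \sum_a ctr R (t - dot a w) *: 'X^(wt a) =
    ctr R t *: ((1 + (-1) *: 'X) ^+ wt w * (1 + (#|F|%:R - 1) *: 'X) ^+ (n - wt w)).
Proof.
elim: n w t => [|n IHn] w t.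
  rewrite (big_pred1 (0 : 'rV_0)) => [|a]; last by rewrite thinmx0 inE eqxx.
  by rewrite /dot /wt !big_ord0 subr0 !expr0 mulr1.
have [c [{}w ->]] : exists c w', w = row_mx c%:M w' :> 'rV_(1 + n).
  by exists (lsubmx (w : 'rV_(1 + n)) 0 0), (rsubmx (w : 'rV_(1 + n)));
    rewrite -mx11_scalar hsubmxK.
rewrite sum_rV_recl wt_recl.
under eq_bigr => b _.
  under eq_bigr => a _ do rewrite dot_recl wt_recl exprD opprD addrA scalerAr.
  rewrite -mulr_sumr IHn; over.
rewrite (bigD1 0) //= eqxx mul0r subr0 mul1r.
under eq_bigr => b /negbTE -> do rewrite /= expr1 -scalerAr.
rewrite -scaler_suml sum_ctr_neq0 -scalerA -scalerDr; congr (_ *: _).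
(* The new factor is [1 + (q - 1) X] if [c = 0] and [1 - X] otherwise; [wn] keeps the subtraction in
   the exponent from truncating. *)
have wn := wt_le w; case: eqVneq => /= c0.
  by rewrite add0n subSn // exprS -!mul_polyC; ring.
by rewrite add1n subSS exprS -!mul_polyC; ring.
Qed.

(** Coefficient of [X^k] in [gen_ctr_dot] at [t = 0], where [ctr] equals [q - 1]. *)
Lemma sum_ctr_wt (R : realFieldType) (F : finFieldType) (n k : nat)
    (w : 'rV[F]_n) :
  \sum_(a | wt a == k) ctr R (- dot a w) =
    (#|F|%:R - 1) * krawtchouk R #|F| n k (wt w).
Proof.
have /(congr1 (coefp k)) := gen_ctr_dot R w 0; rewrite /= coefZ -krawtchoukE.
rewrite /ctr eqxx mulr1 => <-; rewrite coef_sum big_mkcond; apply: eq_bigr => a _.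
by rewrite coefZ coefXn sub0r eq_sym; case: eqP => _; rewrite ?mulr1 ?mulr0.
Qed.

(** At [w = 0] every term of [sum_ctr_wt] is [q - 1], a nonzero factor that cancels. *)
Lemma card_wt (R : realFieldType) (F : finFieldType) (n k : nat) :
  #|[set a : 'rV[F]_n | wt a == k]|%:R = (#|F|%:R - 1) ^+ k * 'C(n, k)%:R :> R.
Proof.
have wt0 : wt (0 : 'rV[F]_n) = 0%N.
  by rewrite /wt big1 // => i _; rewrite mxE eqxx.
have q1 : #|F|%:R - 1 != 0 :> R.
  by rewrite subr_eq0 (eqr_nat R _ 1) gtn_eqF // card_finNzRing_gt1.
apply: (mulfI q1); have := sum_ctr_wt R k (0 : 'rV[F]_n).
rewrite wt0 krawtchoukE expr0 mul1r subn0 coef_1DZX_exp => <-.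
under eq_bigr => a _.
  rewrite /dot big1 => [|i _]; last by rewrite mxE mulr0.
  rewrite oppr0 /ctr eqxx mulr1; over.
by rewrite sumr_const cardsE mulr_natr.
Qed.

Lemma sum_sq_ge (R : realFieldType) (I : finType) (N : I -> nat)
    (q := #|I|) (M := (\sum_i N i)%N) (r := (M %% q)%N) :
  r%:R * (q%:R - r%:R) <= q%:R * (\sum_i (N i)%:R ^+ 2) - M%:R ^+ 2 :> R.
Proof.
set m := (M %/ q)%N.
(* Consecutive integers: no [N i] lies strictly between [m] and [m + 1]. *)
have gap i : 0 <= ((N i)%:R - m%:R) * ((N i)%:R - m%:R - 1) :> R.
  case: (leqP (N i) m) => le_Nm.
    have : (N i)%:R <= m%:R :> R by rewrite ler_nat.
    by move=> ?; apply: mulr_le0; lra.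
  have : m.+1%:R <= (N i)%:R :> R by rewrite ler_nat.
  by rewrite -natr1 => ?; apply: mulr_ge0; lra.
have : 0 <= q%:R * \sum_i ((N i)%:R - m%:R) * ((N i)%:R - m%:R - 1) :> R.
  by apply: mulr_ge0 => //; apply: sumr_ge0.
have -> : \sum_i ((N i)%:R - m%:R) * ((N i)%:R - m%:R - 1) =
    \sum_i (N i)%:R ^+ 2 - (2 * m%:R + 1) * M%:R + q%:R * (m%:R * (m%:R + 1)) :> R.
  rewrite natr_sum mulr_sumr [q%:R * _]mulr_natl -[_ *+ q]sumr_const -sumrB -big_split /=.
  by apply: eq_bigr => i _; ring.
(* With [M = m q + r], the nonnegative quantity is exactly the difference of the two sides. *)
have -> : M%:R = m%:R * q%:R + r%:R :> R by rewrite -natrM -natrD -divn_eq.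
by rewrite -subr_ge0 => H; rewrite -subr_ge0; move: H; congr (_ <= _); ring.
Qed.

Lemma sum_ctr_ge (R : realFieldType) (F : finFieldType) (T : finType)
    (C : {set T}) (f : T -> F) (q := #|F|) (r := (#|C| %% q)%N) :
  r%:R * (q%:R - r%:R) <= \sum_(u in C) \sum_(v in C) ctr R (- (f u - f v)).
Proof.
pose N t := (\sum_(u in C) (f u == t))%N.
have sumN : (\sum_t N t = #|C|)%N.
  rewrite exchange_big -sum1_card; apply: eq_bigr => u _.
  by rewrite (bigD1 (f u)) //= eqxx big1 // => t; rewrite eq_sym => /negbTE ->.
have := sum_sq_ge R N; rewrite /= sumN; congr (_ <= _).
transitivity (\sum_(u in C) \sum_(v in C) (q%:R * (f u == f v)%:R - 1) : R); last first.
  apply: eq_bigr => u _; apply: eq_bigr => v _.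
  by rewrite /ctr oppr_eq0 subr_eq0.
under [RHS]eq_bigr do rewrite sumrB -mulr_sumr sumr_const.
rewrite sumrB -mulr_sumr sumr_const -[_%:R *+ #|C|]mulr_natr -expr2; congr (_ * _ - _).
(* Both sides count the pairs with [f u = f v], here sorted by the common value [t]. *)
transitivity (\sum_t \sum_(u in C) \sum_(v in C) (f u == t)%:R * (f v == t)%:R : R).
  apply: eq_bigr => t _; rewrite /N natr_sum expr2 mulr_suml.
  by apply: eq_bigr => u _; rewrite mulr_sumr.
rewrite exchange_big; apply: eq_bigr => u _ /=.
rewrite exchange_big; apply: eq_bigr => v _ /=.
rewrite (bigD1 (f u)) //= eqxx mul1r eq_sym big1 ?addr0 // => t.
by rewrite eq_sym => /negbTE ->; rewrite mul0r.
Qed.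

Lemma sum_dist_distr (R : realFieldType) (F : finFieldType) (n : nat)
    (C : {set 'rV[F]_n}) (P : nat -> R) :
  \sum_(0 <= i < n.+1) P i * dist_distr R C i =
    #|C|%:R^-1 * \sum_(u in C) \sum_(v in C) P (hamming_dist u v).
Proof.
rewrite pair_big /= mulr_sumr big_mkord.
(* Distances are at most [n], so [inord] never falls back on its default. *)
pose d (p : 'rV[F]_n * 'rV[F]_n) : 'I_n.+1 := inord (hamming_dist p.1 p.2).
have dE p : d p = hamming_dist p.1 p.2 :> nat.
  by rewrite inordK // ltnS -wt_sub wt_le.
rewrite (partition_big d predT) //=; apply: eq_bigr => i _.
rewrite (eq_bigr (fun=> #|C|%:R^-1 * P i)) => [|p /andP[_ /eqP <-]]; last by rewrite dE.
rewrite sumr_const -[RHS]mulr_natr /dist_distr [LHS]mulrC [RHS]mulrAC [_^-1 * _%:R]mulrC.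
congr (_%:R / _ * _); apply: eq_card => p.
by case: p => u v; rewrite inE in_setX [RHS]unfold_in /= -val_eqE /= dE.
Qed.

Theorem theorem2p6 (R : realFieldType) (F : finFieldType) (n : nat)
    (C : {set 'rV[F]_n}) (hC : C != set0) (k : nat)
    (hk : (1 <= k <= n)%N) :
  let q := #|F| in
  let M := #|C| in
  let r := (M %% q)%N in
  \sum_(0 <= i < n.+1) krawtchouk R q n k i * dist_distr R C i >=
    M%:R^-1 * (r%:R * (q%:R - r%:R) * (q%:R - 1) ^+ (k - 1) * 'C(n, k)%:R).
Proof.
rewrite /=; set q := #|F|; set r := (_ %% q)%N; rewrite sum_dist_distr.
apply: ler_wpM2l; first by rewrite invr_ge0.
have q1 : 0 < q%:R - 1 :> R by rewrite subr_gt0 (ltr_nat R 1) card_finNzRing_gt1.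
(* The factor [q - 1] matches [sum_ctr_wt] on one side; on the other, as [k >= 1], it completes the
   number [(q - 1)^k 'C(n, k)] of vectors of weight [k]. The inequality then holds term by term in
   [a]. *)
rewrite -(ler_pM2l q1).
have -> : (q%:R - 1) * (r%:R * (q%:R - r%:R) * (q%:R - 1) ^+ (k - 1) * 'C(n, k)%:R) =
    \sum_(a : 'rV[F]_n | wt a == k) r%:R * (q%:R - r%:R) :> R.
  rewrite sumr_const -[RHS]mulr_natr -cardsE card_wt.
  by rewrite -(subnK (proj1 (andP hk))) exprD expr1 addnK; ring.
have -> : (q%:R - 1) * \sum_(u in C) \sum_(v in C) krawtchouk R q n k (hamming_dist u v) =
    \sum_(a | wt a == k) \sum_(u in C) \sum_(v in C) ctr R (- (dot a u - dot a v)).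
  rewrite [RHS]exchange_big mulr_sumr; apply: eq_bigr => u _ /=.
  rewrite [RHS]exchange_big mulr_sumr; apply: eq_bigr => v _ /=.
  by rewrite -wt_sub -sum_ctr_wt; apply: eq_bigr => a _; rewrite dotBr.
by apply: ler_sum => a _; apply: sum_ctr_ge.
Qed.
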